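(* Let $a_n=A_{0123}(n)$. Then $a_0=a_1=1$, $a_2=2$, and $$a_n=5a_{n-1}-6a_{n-2}+a_{n-3},\qquad n\ge 3.$$
   Context: An ascent in a sequence $x_1\cdots x_k$ is an index $j$ with $x_j<x_{j+1}$; $\mathrm{asc}(x)$ is the number of ascents. An ascent sequence of length $n$ is a sequence $x_1\cdots x_n$ of non-negative integers with $x_1=0$ and $x_i\le \mathrm{asc}(x_1\cdots x_{i-1})+1$ for $1<i\le n$; the empty sequence is the unique ascent sequence of length $0$. A sequence $\pi$ contains a pattern $\tau=\tau_1\cdots\tau_m$ (a sequence of non-negative integers) if there are indices $f(1)<\cdots<f(m)$ such that for all $i,j$: $\pi_{f(i)}<\pi_{f(j)}$ iff $\tau_i<\tau_j$, and $\pi_{f(i)}>\pi_{f(j)}$ iff $\tau_i>\tau_j$; otherwise $\pi$ avoids $\tau$. $A_\tau(n)$ is the number of ascent sequences of length $n$ avoiding $\tau$. *)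

(* Defs.v *)
From mathcomp Require Import all_boot.

Set Implicit Arguments.
Unset Strict Implicit.
Unset Printing Implicit Defensive.

(* Sequences are 0-indexed: x_1 ... x_n is nth 0 x 0, ..., nth 0 x n.-1. *)

Definition asc (x : seq nat) : nat :=
  count (fun j => nth 0 x j < nth 0 x j.+1) (iota 0 (size x).-1).

(* On the empty sequence both conjuncts hold, thanks to the default 0. *)
Definition ascent_seq (x : seq nat) : bool :=
  (nth 0 x 0 == 0) &&
  all (fun i => nth 0 x i <= (asc (take i x)).+1) (iota 1 (size x).-1).

Definition contains (pi tau : seq nat) : bool :=
  [exists f : {ffun 'I_(size tau) -> 'I_(size pi)},
    [forall i : 'I_(size tau), forall j : 'I_(size tau),
      [&& (i < j) ==> (f i < f j),
          (nth 0 pi (f i) < nth 0 pi (f j)) == (nth 0 tau i < nth 0 tau j)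
        & (nth 0 pi (f i) > nth 0 pi (f j)) == (nth 0 tau i > nth 0 tau j)]]].

Definition avoids (pi tau : seq nat) : bool := ~~ contains pi tau.

Definition tuple_vals (n : nat) (t : n.-tuple 'I_n) : seq nat :=
  [seq val i | i <- t].

(* Entries of an ascent sequence of length n are smaller than n
   (ascent_seq_lt), so counting over n.-tuple 'I_n misses none of them;
   num_avoidingP states that this is the number of all such sequences. *)
Definition num_avoiding (tau : seq nat) (n : nat) : nat :=
  #|[set t : n.-tuple 'I_n |
      ascent_seq (tuple_vals t) && avoids (tuple_vals t) tau]|.

Lemma asc_le (x : seq nat) : asc x <= (size x).-1.
Proof. by rewrite /asc (leq_trans (count_size _ _)) ?size_iota. Qed.

Lemma ascent_seq_lt (x : seq nat) :
  ascent_seq x -> all (fun a => a < size x) x.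
Proof.
case/andP=> /eqP x0 /allP xP; apply/(all_nthP 0) => -[|i] lti.
  by rewrite x0.
have /xP xi : i.+1 \in iota 1 (size x).-1.
  by rewrite mem_iota /= add1n prednK ?(leq_trans _ lti).
apply: leq_ltn_trans xi _; apply: leq_ltn_trans (lti); rewrite ltnS.
by apply: leq_trans (asc_le _) _; rewrite size_take lti.
Qed.

Lemma num_avoidingP (tau : seq nat) (n : nat) :
  exists s : seq (seq nat),
    [/\ uniq s, size s = num_avoiding tau n
      & forall x, (x \in s) = [&& size x == n, ascent_seq x & avoids x tau]].
Proof.
pose S := [set t : n.-tuple 'I_n |
  ascent_seq (tuple_vals t) && avoids (tuple_vals t) tau].
exists [seq tuple_vals t | t <- enum S]; split.
- rewrite map_inj_uniq ?enum_uniq // => t u /(inj_map val_inj).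
  exact: val_inj.
- by rewrite size_map -cardE.
move=> x; apply/mapP/and3P => [[t]|[/eqP sx ax vx]].
  by rewrite mem_enum inE => /andP[at_ vt] ->; rewrite size_map size_tuple.
have ltx := ascent_seq_lt ax; rewrite sx in ltx.
have szx : size (pmap (insub : nat -> option 'I_n) x) == n.
  rewrite size_pmap_sub -[X in _ == X]sx; move: ltx.
  by rewrite all_count.
have valx : tuple_vals (Tuple szx) = x.
  rewrite /tuple_vals /= (pmap_filter (insubK _)).
  apply/all_filterP; apply: sub_all ltx => a lta /=.
  by rewrite insubT.
by exists (Tuple szx); rewrite ?mem_enum ?inE ?valx ?ax.
Qed.

(* Main.v *)
Require Import Defs.
From mathcomp Require Import all_boot all_order all_algebra.
From mathcomp Require Import zify.

Set Implicit Arguments.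
Unset Strict Implicit.
Unset Printing Implicit Defensive.

(** In an ascent sequence the first nonzero letter is a 1, preceded by a 0, so
    avoiding 0123 means that the letters [>= 2] decrease weakly.  Hence only the
    first of them is constrained by the number of ascents, and the sequences are
    read by an automaton whose state is the last letter and the number [m] of
    ascents as long as all letters are 0 or 1, and afterwards [k], where [k + 1]
    is the last letter [>= 2].  If [E] shifts the length, the numbers [F_m] of
    completions from corresponding states satisfy
    [(E - 3) F_(m+1) = (E - 2) F_m]; together with the first two steps from the
    initial state this gives [((E - 1)^2 (E - 3) - (E - 2)) F_0 = 0], and
    [(E - 1)^2 (E - 3) - (E - 2) = E^3 - 5 E^2 + 6 E - 1]. *)

Local Open Scope nat_scope.

(** * Ascents and subsequences under appending a letter; occurrences of 0123 *)

Lemma asc_rcons (p : seq nat) (x : nat) :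
  0 < size p -> asc (rcons p x) = asc p + (last 0 p < x).
Proof.
case/lastP: p => // p y _; rewrite /asc !size_rcons !succnK -[in LHS]addn1 iotaD.
rewrite count_cat /= add0n addn0 last_rcons; congr (_ + _).
  apply: eq_in_count => j; rewrite mem_iota /= add0n => ltj.
  by rewrite !(nth_rcons _ (rcons p y)) size_rcons !ltnS ltj (ltnW ltj).
by rewrite !nth_rcons !size_rcons !ltnS leqnn !eqxx !ltnn.
Qed.

Lemma ascent_seq_rcons (p : seq nat) (x : nat) :
  0 < size p -> ascent_seq (rcons p x) = ascent_seq p && (x <= (asc p).+1).
Proof.
case/lastP: p => // p y _; rewrite /ascent_seq !size_rcons !succnK.
rewrite -(addn1 (size p)) iotaD all_cat /= andbT add1n andbA.
congr (_ && _ && _).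
- by rewrite nth_rcons size_rcons.
- apply: eq_in_all => j; rewrite mem_iota add1n => /andP[_ ltj].
  rewrite nth_rcons size_rcons ltj -(cats1 _ x) takel_cat //.
  by rewrite size_rcons ltnW.
by rewrite nth_rcons size_rcons ltnn eqxx -(cats1 _ x) take_size_cat ?size_rcons.
Qed.

Lemma subseq_rcons_iff (T : eqType) (s p : seq T) (x : T) :
  subseq s (rcons p x) <->
  subseq s p \/ exists2 s', s = rcons s' x & subseq s' p.
Proof.
split=> [|[sp|[s' -> sp]]]; first last.
- by rewrite -!cats1 cat_subseq.
- exact: subseq_trans sp (subseq_rcons _ _).
case: (lastP s) => [|s' z]; first by left; exact: sub0seq.
rewrite -subseq_rev !rev_rcons /=; case: eqP => [->|_].
  by rewrite subseq_rev => sp; right; exists s'.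
by rewrite -rev_rcons subseq_rev; left.
Qed.

(** Links the index maps in the definition of [contains] with [subseq]. *)
Lemma subseq_nthP (T : eqType) (x0 : T) (s x : seq T) :
  reflect (exists t, [/\ sorted ltn t, all (fun i => i < size x) t
                       & s = [seq nth x0 x i | i <- t]])
          (subseq s x).
Proof.
apply: (iffP subseqP) => [[m sm ->]|[t [st lt_t ->]]]; last first.
  apply/subseqP; rewrite -[X in subseq _ X](mkseq_nth x0) map_subseq //.
  apply/(subseq_uniqP (iota_uniq _ _)).
  apply: (irr_sorted_eq ltn_trans ltnn) => //.
    by apply: sorted_filter; [exact: ltn_trans | exact: iota_ltn_sorted].
  move=> i; rewrite mem_filter mem_iota /= add0n; case: (boolP (i \in t)) => //.
  by move=> /(allP lt_t) ->.
exists (mask m (iota 0 (size x))); split.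
- apply: (subseq_sorted ltn_trans (mask_subseq _ _)); exact: iota_ltn_sorted.
- by apply/allP => i /mem_mask; rewrite mem_iota.
- by rewrite map_mask -/(mkseq _ _) mkseq_nth.
Qed.

Lemma contains_0123P (x : seq nat) :
  reflect (exists a b c d, [/\ a < b, b < c, c < d & subseq [:: a; b; c; d] x])
          (contains x [:: 0; 1; 2; 3]).
Proof.
apply: (iffP existsP) => [[f /forallP fP]|[a [b [c [d [ab bc cd]]]]]].
  have {}fP (i j : 'I_4) (ltij : i < j) : f i < f j /\ nth 0 x (f i) < nth 0 x (f j).
    have /forallP /(_ j) /and3P[/implyP/(_ ltij) -> /eqP -> _] := fP i.
    by split=> //; case: i j ltij => [[|[|[|[|i]]]] // hi] [[|[|[|[|j]]]] // hj].
  pose o i (h : i < 4) : 'I_(size [:: 0; 1; 2; 3]) := Ordinal h.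
  have [l01 v01] := fP (o 0 isT) (o 1 isT) isT.
  have [l12 v12] := fP (o 1 isT) (o 2 isT) isT.
  have [l23 v23] := fP (o 2 isT) (o 3 isT) isT.
  do 4 eexists; split; [exact: v01 | exact: v12 | exact: v23 |].
  apply/(subseq_nthP 0); exists [seq val (f i) | i <- [:: o 0 isT; o 1 isT; o 2 isT; o 3 isT]].
  by rewrite /= l01 l12 l23 !ltn_ord.
case/(subseq_nthP 0) => t [].
case: t => [|i [|j [|k [|l [|? ?]]]]] //=.
move=> /and4P[ij jk kl _] /and5P[ix jx kx lx _] [Ea Eb Ec Ed].
(* All four positions are below [size x], so [insubd] returns them unchanged. *)
exists [ffun o : 'I_4 => insubd (Ordinal ix) (nth 0 [:: i; j; k; l] o)].
apply/forallP => -[u hu]; apply/forallP => -[v hv]; rewrite !ffunE !val_insubd.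
by case: u hu => [|[|[|[|u]]]] // hu; case: v hv => [|[|[|[|v]]]] //= hv;
   rewrite ?ix ?jx ?kx ?lx -?Ea -?Eb -?Ec -?Ed; lia.
Qed.

(** * The automaton that reads the good sequences *)

Definition good (p : seq nat) : bool :=
  ascent_seq p && avoids p [:: 0; 1; 2; 3].

(** A new occurrence of 0123 must end in the appended letter, on top of a 012 in [p]. *)
Lemma avoids_0123_rcons (p : seq nat) (x : nat) :
  avoids (rcons p x) [:: 0; 1; 2; 3] <->
  avoids p [:: 0; 1; 2; 3] /\
  forall a b c, a < b -> b < c -> subseq [:: a; b; c] p -> x <= c.
Proof.
rewrite /avoids; split=> [/contains_0123P np|[/contains_0123P np le_x]].
  split=> [|a b c ab bc abc].
    apply/contains_0123P => -[a [b [c [d [ab bc cd abcd]]]]]; apply: np.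
    by exists a, b, c, d; split=> //; apply/subseq_rcons_iff; left.
  rewrite leqNgt; apply/negP => cx; apply: np; exists a, b, c, x; split=> //.
  by apply/subseq_rcons_iff; right; exists [:: a; b; c].
apply/contains_0123P => -[a [b [c [d [ab bc cd]]]]].
case/subseq_rcons_iff => [abcd|[s' /(@rcons_inj _ [:: a; b; c]) [<- dx] abc]].
  by apply: np; exists a, b, c, d.
by move: cd; rewrite dx ltnNge (le_x a b c).
Qed.

Lemma good_rcons (p : seq nat) (x : nat) : 0 < size p ->
  good (rcons p x) <->
  [/\ good p, x <= (asc p).+1
    & forall a b c, a < b -> b < c -> subseq [:: a; b; c] p -> x <= c].
Proof.
move=> p_gt0; rewrite /good ascent_seq_rcons //; split.
  by case/andP=> /andP[-> ->] /avoids_0123_rcons[-> ?].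
by case=> /andP[-> p_av] -> le_x; apply/avoids_0123_rcons.
Qed.

Lemma good_catl (p y : seq nat) : 0 < size p -> good (p ++ y) -> good p.
Proof.
move=> p_gt0; elim/last_ind: y => [|y x IHy]; first by rewrite cats0.
rewrite -rcons_cat => /good_rcons[|/IHy //].
by rewrite size_cat ltn_addr.
Qed.

(* [Bin b m]: only letters 0 and 1 so far, the last one being [b], with [m]
   ascents.  [Dec k]: the last letter [>= 2] was [k.+1].  In both cases the
   letters that may follow are [0, ..., (bound st).+1]. *)
Inductive state := Bin of bool & nat | Dec of nat.

Definition bound (st : state) : nat :=
  match st with Bin _ m => m | Dec k => k end.

Definition step (st : state) (x : nat) : state :=
  if x < 2 then
    if st is Bin b m then Bin (x == 1) (m + (b < x)) else st
  else Dec x.-1.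

Fixpoint accepts (st : state) (y : seq nat) : bool :=
  if y is x :: y' then (x < (bound st).+2) && accepts (step st x) y' else true.

(** For [Dec k], the last two clauses make [k.+1] the smallest top of a 012 in [p]. For [Bin], the
    last clause supplies the 01 that a first letter [>= 2] completes to a 012. *)
Definition reached (st : state) (p : seq nat) : Prop :=
  match st with
  | Bin b m => [/\ 0 \in p, all (fun a => a < 2) p, asc p = m, last 0 p = b
                 & 0 < m -> subseq [:: 0; 1] p]
  | Dec k => [/\ 0 < k, k <= asc p, subseq [:: 0; 1; k.+1] p
               & forall a b c, a < b -> b < c -> subseq [:: a; b; c] p -> k < c]
  end.

Lemma reached_size (st : state) (p : seq nat) : reached st p -> 0 < size p.
Proof. by case: st => [b m|k]; case: p => // -[]. Qed.

(** In [Bin] only the ascent bound can bind, as there is no 012 yet. In [Dec k] the smallest top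
    [k.+1] binds, and [k <= asc p] keeps it within the ascent bound. *)
Lemma good_rcons_reached (st : state) (p : seq nat) (x : nat) :
  reached st p -> good p -> good (rcons p x) = (x < (bound st).+2).
Proof.
move=> rp gp; have p_gt0 := reached_size rp.
apply/idP/idP => [/(good_rcons _ p_gt0)[_ x_asc x_min]|ltx].
  case: st rp => [b m|k] /= [] => [_ _ <- _ _ //|k_gt0 _ s01 _].
  by rewrite ltnS; apply: (x_min 0 1).
apply/(good_rcons _ p_gt0); split=> //.
  by case: st rp ltx => [b m|k] /= [] => [_ _ -> _ _ //|_ k_asc _ _ ltx]; lia.
move=> a b c ab bc abc.
case: st rp ltx => [b' m|k] /= [] => [_ p2 _ _ _|_ _ _ /(_ a b c ab bc abc)]; last lia.
have /(allP p2) : c \in p by apply: (mem_subseq abc); rewrite !inE eqxx !orbT.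
lia.
Qed.

Lemma reached_step (st : state) (p : seq nat) (x : nat) :
  reached st p -> x < (bound st).+2 -> reached (step st x) (rcons p x).
Proof.
move=> rp ltx; have p_gt0 := reached_size rp.
(* A 012 not already in [p] ends in [x], which is then at least 2. *)
have chain a b c : a < b -> b < c -> subseq [:: a; b; c] (rcons p x) ->
    subseq [:: a; b; c] p \/ c = x /\ 2 <= c.
  move=> ab bc /subseq_rcons_iff[|[s' /(@rcons_inj _ [:: a; b]) [_ cx] _]].
    by left.
  by right; split=> //; lia.
have sub_p s : subseq s p -> subseq s (rcons p x).
  by move=> sp; apply/subseq_rcons_iff; left.
have sub_px s : subseq s p -> subseq (rcons s x) (rcons p x).
  by move=> sp; apply/subseq_rcons_iff; right; exists s.
have asc_x := asc_rcons x p_gt0.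
case: st rp ltx => [b m|k] /= [].
  move=> p0 p2 pm pb p01 ltx; rewrite /step; case: ltnP => x2 /=.
    split.
    - by rewrite mem_rcons inE p0 orbT.
    - by rewrite all_rcons x2.
    - by rewrite asc_x pm pb.
    - by rewrite last_rcons; case: x x2 {ltx chain sub_px sub_p asc_x} => [|[]].
    (* If [m = 0], the ascent just made goes up to a 1, and a 0 of [p] precedes it. *)
    case: m pm p01 ltx => [|m] pm p01 ltx m_gt0; last by apply/sub_p/p01.
    have -> : 1 = x by lia.
    by apply: (sub_px [:: 0]); rewrite sub1seq.
  (* Here [2 <= x <= m.+1], so [m] is positive. *)
  have p01' : subseq [:: 0; 1] p by apply: p01; lia.
  rewrite prednK; last lia; split=> [||| a b' c ab bc abc]; try lia.
  - exact: (sub_px [:: 0; 1]).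
  case: (chain a b' c ab bc abc) => [abc'|]; last lia.
  have /(allP p2) : c \in p by apply: (mem_subseq abc'); rewrite !inE eqxx !orbT.
  lia.
move=> k_gt0 k_asc p01k k_min ltx; rewrite /step; case: ltnP => x2 /=.
  split=> [||| a b c ab bc abc]; [by [] | lia | exact: sub_p |].
  case: (chain a b c ab bc abc) => [|]; [exact: k_min | lia].
(* The 01 below the old [k.+1] also lies below [x]; older tops are at least [k.+1 >= x]. *)
rewrite prednK; last lia; split=> [||| a b c ab bc abc]; try lia.
  apply: (sub_px [:: 0; 1]); apply: subseq_trans p01k.
  exact: (prefix_subseq [:: 0; 1] [:: k.+1]).
case: (chain a b c ab bc abc) => [/(k_min a b c ab bc)|]; lia.
Qed.

Lemma good_cat_accepts (st : state) (p y : seq nat) :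
  reached st p -> good p -> good (p ++ y) = accepts st y.
Proof.
elim: y st p => [|x y IHy] st p rp gp; first by rewrite cats0.
have p_gt0 := reached_size rp; have gpx := good_rcons_reached x rp gp.
rewrite -cat_rcons /=; case: ltnP gpx => [ltx|_] gpx /=.
  by apply: IHy => //; apply: reached_step.
apply/negbTE/negP => /good_catl; rewrite size_rcons gpx; exact/implyP.
Qed.

Lemma good_cons (x : nat) (y : seq nat) :
  good (x :: y) = (x == 0) && accepts (Bin false 0) y.
Proof.
case: eqP => [->|x0]; last by rewrite /good /ascent_seq /=; case: eqP.
rewrite -cat1s; apply: good_cat_accepts => //.
apply/andP; split=> //; apply/contains_0123P => -[a [b [c [d [_ _ _]]]]].
by move=> /size_subseq.
Qed.

(** * Enumeration of the accepted words *)

Fixpoint words (r : nat) (st : state) : seq (seq nat) :=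
  if r is r'.+1 then
    [seq x :: y | x <- iota 0 (bound st).+2, y <- words r' (step st x)]
  else [:: [::]].

Lemma words_uniq (r : nat) (st : state) : uniq (words r st).
Proof.
elim: r st => [|r IHr] st //; apply: allpairs_uniq_dep => [|x _|].
- exact: iota_uniq.
- exact: IHr.
by move=> [x y] [x' y'] _ _ /= [-> ->].
Qed.

Lemma mem_words (r : nat) (st : state) (y : seq nat) :
  (y \in words r st) = (size y == r) && accepts st y.
Proof.
elim: r st y => [|r IHr] st [|x y] //.
  by apply/negbTE/negP => /allpairsPdep[? [? []]].
rewrite [size _ == _]eqSS; apply/allpairsPdep/and3P => [[x' [y' []]]|[sy ltx ay]].
  by rewrite mem_iota IHr => ltx /andP[sy ay] [-> ->].
by exists x, y; rewrite mem_iota IHr sy.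
Qed.

(** The first letter is forced to be 0, whence the shift of the length by one. *)
Lemma num_avoiding_0123_words (n : nat) :
  num_avoiding [:: 0; 1; 2; 3] n.+1 = size (words n (Bin false 0)).
Proof.
have [s [us <- mem_s]] := num_avoidingP [:: 0; 1; 2; 3] n.+1.
rewrite -(size_map (cons 0) (words _ _)); apply/perm_size/uniq_perm => //.
  by rewrite map_inj_uniq ?words_uniq // => y y' [].
move=> [|x y]; rewrite mem_s; first by apply/esym/mapP => -[].
rewrite -/(good (x :: y)) good_cons eqSS; apply/and3P/mapP.
  by case=> sy /eqP -> ay; exists y; rewrite ?mem_words ?sy.
by case=> y'; rewrite mem_words => /andP[sy ay] [-> ->].
Qed.

(** * Linear recurrences for the numbers of completions *)

Definition num_words (r : nat) (st : state) : nat := size (words r st).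

(** The letters [2, ..., m.+1] lead to [Dec 1, ..., Dec m]; this is their joint contribution. *)
Definition num_dec (r m : nat) : nat := \sum_(0 <= u < m) num_words r (Dec u.+1).

Lemma num_words0 (st : state) : num_words 0 st = 1.
Proof. by []. Qed.

Lemma num_decS (r m : nat) :
  num_dec r m.+1 = num_dec r m + num_words r (Dec m.+1).
Proof. by rewrite /num_dec big_nat_recr. Qed.

Lemma num_wordsS (r : nat) (st : state) :
  num_words r.+1 st =
  num_words r (step st 0) + num_words r (step st 1) + num_dec r (bound st).
Proof.
rewrite {1}/num_words /words -/words size_allpairs_dep sumnE big_map.
rewrite -[iota _ _]/(index_iota 0 (bound st).+2) !big_nat_recl // addnA.
by [].
Qed.

(** Letters 0 and 1 keep the state, and [Dec k.+1] allows just one letter more than [Dec k], leading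
    to [Dec k.+1] itself. *)
Lemma num_words_dec_shift (r k : nat) :
  num_words r.+1 (Dec k.+1) + 2 * num_words r (Dec k) =
  3 * num_words r (Dec k.+1) + num_words r.+1 (Dec k).
Proof. by rewrite !num_wordsS /= /step /= num_decS; lia. Qed.

(** By [decE], [num_dec] is [E - 2] applied to the counts for [Dec k], so it inherits their
    relation. *)
Lemma num_dec_shift (r k : nat) :
  num_dec r.+1 k.+1 + 2 * num_dec r k = 3 * num_dec r k.+1 + num_dec r.+1 k.
Proof.
have decE r' k' :
    num_words r'.+1 (Dec k') = 2 * num_words r' (Dec k') + num_dec r' k'.
  by rewrite num_wordsS /step /=; lia.
have := num_words_dec_shift r k; have := num_words_dec_shift r.+1 k.
by rewrite !decE; lia.
Qed.

Lemma num_words_bin0 (r m : nat) :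
  num_words r.+1 (Bin false m) =
  num_words r (Bin false m) + num_words r (Bin true m.+1) + num_dec r m.
Proof. by rewrite num_wordsS /step /= addn0 addn1. Qed.

Lemma num_words_bin1 (r m : nat) :
  num_words r.+1 (Bin true m) =
  num_words r (Bin false m) + num_words r (Bin true m) + num_dec r m.
Proof. by rewrite num_wordsS /step /= !addn0. Qed.

(** Each summand left after reading one letter satisfies this same linear relation, by induction or
    by [num_dec_shift]. *)
Lemma num_words_bin_shift (r : nat) (b : bool) (m : nat) :
  num_words r.+1 (Bin b m.+1) + 2 * num_words r (Bin b m) =
  3 * num_words r (Bin b m.+1) + num_words r.+1 (Bin b m).
Proof.
elim: r b m => [|r IHr] b m.
  by case: b; rewrite ?num_words_bin0 ?num_words_bin1 !num_words0 num_decS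
    num_words0; lia.
have := num_dec_shift r m.
have := IHr false m; have := IHr true m; have := IHr true m.+1.
by case: b; rewrite ?(num_words_bin0 r.+1) ?(num_words_bin1 r.+1)
  ?(num_words_bin0 r) ?(num_words_bin1 r); lia.
Qed.

(** Applying [(E - 1)^2] to the counts for [Bin false 0] gives those for [Bin false 1] plus
    [num_dec _ 1]. Then [E - 3] turns the former into [(E - 2) F_0] and kills the latter, by
    [dec1]. *)
Lemma num_words_rec (r : nat) :
  num_words r.+3 (Bin false 0) + 6 * num_words r.+1 (Bin false 0) =
  5 * num_words r.+2 (Bin false 0) + num_words r (Bin false 0).
Proof.
have dec0 r' : num_dec r' 0 = 0 by rewrite /num_dec big_geq.
have dec1 r' : num_dec r'.+1 1 = 3 * num_dec r' 1.
  by have := num_dec_shift r' 0; rewrite !dec0; lia.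
have := num_words_bin_shift r false 0; have := dec1 r.
have := num_words_bin0 r.+2 0; have := num_words_bin0 r.+1 0.
have := num_words_bin0 r 0; have := num_words_bin1 r.+1 1.
have := num_words_bin1 r 1; rewrite !dec0; lia.
Qed.

Local Open Scope ring_scope.

Theorem theorem4 :
  let a := num_avoiding [:: 0; 1; 2; 3]%N in
  [/\ a 0%N = 1%N, a 1%N = 1%N, a 2%N = 2%N &
      forall n : nat, (3 <= n)%N ->
        (a n)%:Z = 5 * (a (n - 1)%N)%:Z - 6 * (a (n - 2)%N)%:Z
                   + (a (n - 3)%N)%:Z].
Proof.
move=> a; have aS n : a n.+1 = num_words n (Bin false 0).
  exact: num_avoiding_0123_words.
have a0 : a 0%N = 1%N.
  rewrite /a; have [s [us <- mem_s]] := num_avoidingP [:: 0; 1; 2; 3]%N 0.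
  apply: (@perm_size _ _ [:: [::]]); apply: uniq_perm => // y; rewrite mem_s inE.
  case: y => //=; apply/contains_0123P => -[? [? [? [? []]]]] //.
split=> //; rewrite ?aS //.
(* For [n = 3] the term [a 0] is out of reach of [aS], so this case is computed. *)
move=> [|[|[|[|n]]]] // _; first by rewrite /= !aS a0.
rewrite !subSS !subn0 !aS.
by have := num_words_rec n; lia.
Qed.
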